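(* Let $V$ be a countable set. Then for every separable nondegenerate $C^*$-correspondence $X$ over $c_0(V)$ there exists a directed graph $E$ with vertex set $V$ such that $X$ is isomorphic, as a $C^*$-correspondence over $c_0(V)$, to the graph correspondence $X_E$.
   Context: $V$ is a countable set regarded as a discrete space, and $c_0(V)$ is the commutative $C^*$-algebra of complex functions on $V$ vanishing at infinity. A directed graph $E=(V,E^1,r,s)$ with vertex set $V$ consists of a countable set $E^1$ of edges and arbitrary range and source maps $r,s\colon E^1\to V$. A $C^*$-correspondence over a $C^*$-algebra $A$ is a right Hilbert $A$-module $X$ (with $A$-valued inner product $\langle\cdot,\cdot\rangle$, conjugate-linear in the first variable) together with a left action of $A$ given by a $*$-homomorphism from $A$ into the adjointable operators $\mathcal L(X)$. It is nondegenerate if $\{a\cdot\xi \mid a\in A,\ \xi\in X\}$ has dense linear span in $X$. It is separable if it is separable as a Banach space, for the norm $\|\xi\|=\|\langle\xi,\xi\rangle\|^{1/2}$. If $X,Y$ are $C^*$-correspondences over $A$, a morphism from $X$ to $Y$ is a linear map $\psi\colon X\to Y$ with $\psi(a\cdot\xi\cdot b)=a\cdot\psi(\xi)\cdot b$ and $\langle\psi(\xi),\psi(\eta)\rangle=\langle\xi,\eta\rangle$ for all $a,b\in A$ and $\xi,\eta\in X$. An isomorphism is a bijective morphism. The graph correspondence $X_E$ of a directed graph $E=(V,E^1,r,s)$ is the nondegenerate $C^*$-correspondence over $c_0(V)$ given by $$X_E=\Bigl\{\xi\colon E^1\to\mathbb C \ \Bigm|\ \text{the map } v\mapsto\sum_{s(e)=v}|\xi(e)|^2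 \text{ is in } c_0(V)\Bigr\},$$ with module actions and inner product $$(a\cdot\xi\cdot b)(e)=a(r(e))\,\xi(e)\,b(s(e)),\qquad \langle\xi,\eta\rangle(v)=\sum_{s(e)=v}\overline{\xi(e)}\,\eta(e)$$ for $a,b\in c_0(V)$, $\xi,\eta\in X_E$, $e\in E^1$, $v\in V$. *)

(* Defs.v *)
From HB Require Import structures.
From mathcomp Require Import all_boot all_order all_algebra finmap.
From mathcomp Require Import complex.
From mathcomp Require Import all_classical all_reals all_analysis.
From mathcomp Require Import ring.
Set Implicit Arguments.
Unset Strict Implicit.
Unset Printing Implicit Defensive.
Import Order.TTheory GRing.Theory Num.Theory numFieldNormedType.Exports.
Local Open Scope classical_set_scope.
Local Open Scope ring_scope.

Section Sums.
Variable R : realType.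
Local Notation C := R[i].
Implicit Types (T : choiceType).

(* The complex numbers are R[i].  On R[i], [0 < e] means that e is real and
   positive, and the norm [`|z|] is the modulus, seen as an element of R[i]. *)

(* Unconditional convergence: the finite partial sums over subsets of D tend
   to l along the directed set of finite subsets of D. *)
Definition has_sum T (D : set T) (f : T -> C) (l : C) : Prop :=
  forall e : C, 0 < e -> exists2 F : {fset T}, [set` F] `<=` D &
    forall G : {fset T}, (F `<=` G)%fset -> [set` G] `<=` D ->
      `|l - \sum_(t <- G) f t| < e.

(* The sum of f over D; the junk value 0 is used when the sum does not exist.
   [has_sum_unique] makes this well defined. *)
Definition csum T (D : set T) (f : T -> C) : C := xget 0 (has_sum D f).

Lemma fsubU T (D : set T) (F G : {fset T}) :
  [set` F] `<=` D -> [set` G] `<=` D -> [set` (F `|` G)%fset] `<=` D.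
Proof.
by move=> FD GD t /=; rewrite in_fsetU => /orP[]; [exact: FD|exact: GD].
Qed.

Lemma has_sum_unique T (D : set T) f l m :
  has_sum D f l -> has_sum D f m -> l = m.
Proof.
move=> fl fm; apply/eqP; rewrite -subr_eq0 -normr_eq0; apply/negPn/negP => n0.
have e0 : 0 < `|l - m| / 2 by rewrite divr_gt0// lt_neqAle eq_sym n0 normr_ge0.
have [F FD Fl] := fl _ e0; have [G GD Gm] := fm _ e0.
have UD := fsubU FD GD.
have := ltrD (Fl _ (fsubsetUl F G) UD) (Gm _ (fsubsetUr F G) UD).
rewrite -splitr => /lt_geF/negP; apply.
rewrite [X in _ <= _ + X]distrC; apply: le_trans (ler_normD _ _).
by rewrite addrA subrK.
Qed.

Lemma csumE T (D : set T) f l : has_sum D f l -> csum D f = l.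
Proof. by move=> fl; rewrite /csum; case: xgetP => [x _ /has_sum_unique|/(_ l)]//; exact. Qed.

Lemma has_sum_eq T (D : set T) f g l : (forall t, D t -> f t = g t) ->
  has_sum D f l -> has_sum D g l.
Proof.
move=> fg fl e /fl[F FD Fl]; exists F => // G FG GD.
by rewrite (eq_big_seq f) ?Fl// => t /GD/fg/esym.
Qed.

Lemma has_sumD T (D : set T) f g l m : has_sum D f l -> has_sum D g m ->
  has_sum D (fun t => f t + g t) (l + m).
Proof.
move=> fl gm e e0; have e20 : 0 < e / 2 by rewrite divr_gt0.
have [F FD Fl] := fl _ e20; have [G GD Gm] := gm _ e20.
exists (F `|` G)%fset; first exact: fsubU.
move=> H; rewrite fsubUset => /andP[FH GH] HD.
rewrite big_split/= opprD addrACA; apply: le_lt_trans (ler_normD _ _) _.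
by rewrite [e]splitr ltrD ?Fl ?Gm.
Qed.

Lemma has_sumZ T (D : set T) a f l : has_sum D f l ->
  has_sum D (fun t => a * f t) (a * l).
Proof.
move=> fl e e0; have a0 : 0 < `|a| + 1 by rewrite ltr_wpDl.
have [|F FD Fl] := fl (e / (`|a| + 1)); first by rewrite divr_gt0.
exists F => // G FG GD; rewrite -mulr_sumr -mulrBr normrM.
have := Fl _ FG GD; rewrite ltr_pdivlMr// mulrC; apply: le_lt_trans.
by rewrite ler_wpM2r// lerDl.
Qed.

Lemma has_sum_conj T (D : set T) f l : has_sum D f l ->
  has_sum D (fun t => (f t)^*) (l^*).
Proof.
move=> fl e /fl[F FD Fl]; exists F => // G FG GD.
by rewrite -rmorph_sum -rmorphB norm_conjC Fl.
Qed.

Lemma le_sum_fset T (D : set T) f (F G : {fset T}) :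
  (forall t, D t -> 0 <= f t) -> (F `<=` G)%fset -> [set` G] `<=` D ->
  \sum_(t <- F) f t <= \sum_(t <- G) f t :> C.
Proof.
move=> f0 FG GD; rewrite [leRHS](bigID (mem F))/=.
rewrite [X in _ <= X + _](_ : _ = \sum_(t <- F) f t); last first.
  rewrite -big_filter; apply: perm_big; apply: uniq_perm.
  - exact/filter_uniq/fset_uniq.
  - exact: fset_uniq.
  by move=> t; rewrite mem_filter/=; case: (boolP (t \in F)) => //= /(fsubsetP FG).
rewrite lerDl big_seq_cond; apply: sumr_ge0 => t /andP[tG _].
exact/f0/GD.
Qed.

Lemma nneg_sum T (D : set T) f (B : C) : (forall t, D t -> 0 <= f t) ->
  (forall G : {fset T}, [set` G] `<=` D -> \sum_(t <- G) f t <= B) ->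
  exists l, [/\ has_sum D f l,
    (forall G : {fset T}, [set` G] `<=` D -> \sum_(t <- G) f t <= l) &
    (forall M, (forall G : {fset T}, [set` G] `<=` D -> \sum_(t <- G) f t <= M) ->
       l <= M)].
Proof.
move=> f0 fB.
have s0 (G : {fset T}) : [set` G] `<=` D -> 0 <= \sum_(t <- G) f t.
  by move=> GD; rewrite big_seq_cond sumr_ge0// => t; rewrite andbT => /GD/f0.
have ReK x : 0 <= x -> (complex.Re x)%:C%C = x :> C.
  by move=> /ger0_real/RRe_real.
pose S := [set x : R | exists2 G : {fset T}, [set` G] `<=` D &
  x%:C%C = \sum_(t <- G) f t].
have D0 : [set` (fset0 : {fset T})] `<=` D by move=> t /=; rewrite in_fset0.
have S0 : S 0 by exists fset0 => //; rewrite big_seq_fset0.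
have UB M : (forall G : {fset T}, [set` G] `<=` D -> \sum_(t <- G) f t <= M) ->
    M = (complex.Re M)%:C%C /\ ubound S (complex.Re M).
  move=> fM; have M0 : 0 <= M by have := fM _ D0; rewrite big_seq_fset0.
  split; first by rewrite ReK.
  by move=> x [G GD xE]; rewrite -lecR xE (ReK M M0) fM.
have supS : has_sup S by split; [exists 0|exists (complex.Re B); exact: (UB _ fB).2].
have ub (G : {fset T}) : [set` G] `<=` D -> \sum_(t <- G) f t <= (sup S)%:C%C.
  move=> GD; rewrite -(ReK _ (s0 _ GD)) lecR; apply: sup_upper_bound => //.
  by exists G => //; rewrite ReK// s0.
exists (sup S)%:C%C; split => //; last first.
  by move=> M /UB[-> MS]; rewrite lecR; apply: ge_sup => //; exists 0.
move=> e e0; have eE := ReK _ (ltW e0).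
have Re0 : 0 < complex.Re e by rewrite -ltcR eE.
have [x [F FD xE] xS] := sup_adherent Re0 supS.
exists F => // G FG GD; rewrite ger0_norm ?subr_ge0 ?ub//.
rewrite ltrBlDr -ltrBlDl; apply: lt_le_trans (le_sum_fset f0 FG GD).
by rewrite -xE -eE -rmorphB ltcR.
Qed.

Lemma nneg_has_sum T (D : set T) f l : (forall t, D t -> 0 <= f t) ->
  has_sum D f l ->
  (forall G : {fset T}, [set` G] `<=` D -> \sum_(t <- G) f t <= l) /\
  (forall M, (forall G : {fset T}, [set` G] `<=` D -> \sum_(t <- G) f t <= M) ->
     l <= M).
Proof.
move=> f0 fl; have [F FD Fl] := fl 1 ltr01.
have s0 (G : {fset T}) : [set` G] `<=` D -> 0 <= \sum_(t <- G) f t.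
  by move=> GD; rewrite big_seq_cond sumr_ge0// => t; rewrite andbT => /GD/f0.
have [|l' [fl' ub lb]] := @nneg_sum T D f (`|l| + 1) f0.
  move=> G GD; have UD := fsubU FD GD.
  apply: le_trans (le_sum_fset f0 (fsubsetUr F G) UD) _.
  rewrite -[leLHS]ger0_norm ?s0// -[X in `|X|](subrKC l).
  apply: le_trans (ler_normD _ _) _.
  by rewrite lerD2l distrC ltW// Fl// fsubsetUl.
by rewrite (has_sum_unique fl fl').
Qed.

Lemma nneg_has_sum_ge0 T (D : set T) f l : (forall t, D t -> 0 <= f t) ->
  has_sum D f l -> 0 <= l.
Proof.
move=> f0 /(nneg_has_sum f0)[/(_ fset0) ub _].
by move: ub; rewrite big_seq_fset0; apply => t /=; rewrite in_fset0.
Qed.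

Lemma le_has_sum T (D : set T) f g l m : (forall t, D t -> 0 <= f t <= g t) ->
  has_sum D f l -> has_sum D g m -> l <= m.
Proof.
move=> fg fl gm.
have f0 t : D t -> 0 <= f t by move=> /fg/andP[].
have g0 t : D t -> 0 <= g t by move=> /fg/andP[]; exact: le_trans.
apply: (nneg_has_sum f0 fl).2 => G GD.
apply: le_trans ((nneg_has_sum g0 gm).1 G GD).
by rewrite big_seq [leRHS]big_seq ler_sum// => t /GD/fg/andP[].
Qed.

Lemma dom_has_sum T (D : set T) f g m : (forall t, D t -> 0 <= f t <= g t) ->
  has_sum D g m -> exists2 l, has_sum D f l & 0 <= l <= m.
Proof.
move=> fg gm.
have f0 t : D t -> 0 <= f t by move=> /fg/andP[].
have g0 t : D t -> 0 <= g t by move=> /fg/andP[]; exact: le_trans.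
have [|l [fl _ _]] := @nneg_sum T D f m f0.
  move=> G GD; apply: le_trans ((nneg_has_sum g0 gm).1 G GD).
  by rewrite big_seq [leRHS]big_seq ler_sum// => t /GD/fg/andP[].
by exists l => //; rewrite (nneg_has_sum_ge0 f0 fl) (le_has_sum fg fl gm).
Qed.

Lemma C_complete X (F : set_system X) (FF : ProperFilter F) (g : X -> C) :
  (forall e : C, 0 < e -> exists2 A, F A & forall x y, A x -> A y -> `|g x - g y| < e) ->
  exists l, forall e : C, 0 < e -> F [set x | `|l - g x| < e].
Proof.
move=> gF.
have ReIm (z : C) : `|complex.Re z|%:C%C <= `|z| /\ `|complex.Im z|%:C%C <= `|z|.
  split; first exact: normc_ge_Re.
  rewrite normc_def lecR -sqrtr_sqr ler_sqrt ?lerDr ?sqr_ge0//.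
  by rewrite addr_ge0// sqr_ge0.
have H (h : C -> R) : (forall z w, h (z - w) = h z - h w) ->
    (forall z, `|h z|%:C%C <= `|z|) ->
    exists l : R, forall e : R, 0 < e -> F [set x | `|l - h (g x)| < e].
  move=> hB hle.
  have : cvg ((h \o g) @ F).
    apply: cauchy_cvg; apply/cauchy_exP => e e0.
    have [|A FA gA] := gF e%:C%C; first by rewrite ltcR.
    have [x Ax] := filter_ex FA; exists (h (g x)).
    rewrite /nbhs/=; apply: filterS FA => y Ay.
    rewrite /ball/=/ball/= -hB -ltcR; apply: le_lt_trans (hle _) _; exact: gA.
  move=> /cvg_ex[l /cvgrPdist_lt hl]; exists l => e e0.
  exact: (hl e e0).
have [a aP] := H (@complex.Re R) (fun z w => raddfB (@complex.Re R : Rcomplex R -> R) z w) (fun z => (ReIm z).1).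
have [b bP] := H (@complex.Im R) (fun z w => raddfB (@complex.Im R : Rcomplex R -> R) z w) (fun z => (ReIm z).2).
exists (a +i* b)%C => e e0.
have eE : (complex.Re e)%:C%C = e by apply: RRe_real; exact: gtr0_real.
have e20 : 0 < complex.Re e / 2 by rewrite divr_gt0// -ltcR eE.
apply: filterS (filterI (aP _ e20) (bP _ e20)) => x [/= ax bx].
rewrite (complexE (_ - _)); apply: le_lt_trans (ler_normD _ _) _.
rewrite normrM complexiE normCi mul1r -eE [complex.Re e]splitr rmorphD.
have nR (u : R) : `|u%:C%C| = `|u|%:C%C :> C.
  by rewrite normc_def/= expr0n addr0 sqrtr_sqr.
by case: (g x) ax bx => p q /= ax bx; rewrite !nR; apply: ltrD; rewrite ltcR.
Qed.
End Sums.

Section CSup.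
Variable R : realType.
Local Notation C := R[i].

(* Least upper bound in R[i] of a bounded set of nonnegative reals (0 when S is
   empty). *)
Definition csup (S : set C) : C := (sup [set complex.Re x | x in S])%:C%C.

Let ReK (x : C) : 0 <= x -> (complex.Re x)%:C%C = x.
Proof. by move=> /ger0_real/RRe_real. Qed.

Lemma csup_le (S : set C) M : 0 <= M -> (forall x, S x -> 0 <= x <= M) -> csup S <= M.
Proof.
move=> M0 SM; rewrite /csup -(ReK M0) lecR.
have [->|/set0P[x Sx]] := eqVneq S set0.
  by rewrite image_set0 sup0 -ler0c ReK.
apply: ge_sup; first by exists (complex.Re x), x.
move=> _ [y /SM/andP[y0 yM] <-].
by rewrite -lecR !ReK.
Qed.

Lemma csup_ub (S : set C) M : (forall x, S x -> 0 <= x <= M) ->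
  forall x, S x -> x <= csup S.
Proof.
move=> SM x Sx; have /andP[x0 xM] := SM _ Sx.
have M0 := le_trans x0 xM.
rewrite -(ReK x0) lecR; apply: sup_upper_bound; last by exists x.
split; first by exists (complex.Re x), x.
exists (complex.Re M) => _ [y /SM/andP[y0 yM] <-].
by rewrite -lecR !ReK.
Qed.

Lemma csup_ge0 (S : set C) M : (forall x, S x -> 0 <= x <= M) -> 0 <= csup S.
Proof.
move=> SM; have [S0|/set0P[x Sx]] := eqVneq S set0.
  by rewrite /csup S0 image_set0 sup0 lexx.
by have /andP[x0 _] := SM _ Sx; apply: le_trans x0 (csup_ub SM Sx).
Qed.

End CSup.

(* Neither a unit nor commutativity is required; the norm takes its values in
   the nonnegative reals of R[i]. *)
Record cstarAlgebra (R : realType) := CStarAlgebra {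
  cstar_sort :> completeNormedModType R[i];
  cmul : cstar_sort -> cstar_sort -> cstar_sort;
  cstar : cstar_sort -> cstar_sort;
  cmulA : associative cmul;
  cmul_linearl : forall b, linear (cmul ^~ b);
  cmul_linearr : forall a, linear (cmul a);
  cstarK : involutive cstar;
  cstar_conjlinear : forall (k : R[i]) a b,
    cstar (k *: a + b) = k^* *: cstar a + cstar b;
  cstarM : forall a b, cstar (cmul a b) = cmul (cstar b) (cstar a);
  cnormM : forall a b, `|cmul a b| <= `|a| * `|b|;
  cnorm_star : forall a, `|cmul (cstar a) a| = `|a| ^+ 2 }.

Section CauchyFilter.
Variables (K : numFieldType) (M : normedModType K) (F : set_system M).
Context {FF : ProperFilter F}.

Lemma cauchy_small : cauchy F -> forall e : K, 0 < e ->
  exists2 A, F A & forall x y, A x -> A y -> `|x - y| < e.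
Proof.
move=> /cauchyP Fc e e0; have [|x Fx] := Fc (e / 2); first by rewrite divr_gt0.
exists (ball x (e / 2)) => // y z; rewrite -!ball_normE /= => xy xz.
rewrite -[y](subrK x) -addrA [e]splitr (le_lt_trans (ler_normD _ _))//.
by rewrite ltrD// distrC.
Qed.

Lemma small_cvg (l : M) : (forall e : K, 0 < e ->
  exists2 A, F A & forall x, A x -> `|l - x| <= e) -> cvg F.
Proof.
move=> H; apply/cvg_ex; exists l; apply/cvgrPdist_le => e /H[A FA Al].
exact: filterS FA.
Qed.

End CauchyFilter.

Section Vanishing.
Variables (R : realType) (V : countType).
Local Notation C := R[i].

(* V is discrete: its compact subsets are the finite ones. *)
Definition vanishing (f : V -> C) : Prop :=
  forall e : C, 0 < e -> finite_set [set v | e <= `|f v|].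

Lemma vanishing_dom (c : C) f g : 0 <= c -> (forall v, `|f v| <= c * `|g v|) ->
  vanishing g -> vanishing f.
Proof.
move=> c0 fg vg e e0; have c1 : 0 < c + 1 by rewrite ltr_wpDl.
apply: sub_finite_set (vg (e / (c + 1)) _); last by rewrite divr_gt0.
move=> v /= ef; rewrite ler_pdivrMr// mulrC.
apply: le_trans ef (le_trans (fg v) _).
by rewrite ler_wpM2r// lerDl.
Qed.

Lemma vanishingD f g : vanishing f -> vanishing g ->
  vanishing (fun v => f v + g v).
Proof.
move=> vf vg e e0; have e20 : 0 < e / 2 by rewrite divr_gt0.
apply: sub_finite_set (_ : finite_set
  ([set v | e / 2 <= `|f v|] `|` [set v | e / 2 <= `|g v|])); last first.
  by rewrite finite_setU; split; [exact: vf|exact: vg].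
move=> v /= efg; apply/orP; apply: contraLR efg; rewrite negb_or.
rewrite -!real_ltNge ?normr_real ?(gtr0_real e0) ?(gtr0_real e20)// => /andP[fe ge].
by rewrite (le_lt_trans (ler_normD _ _))// [e]splitr ltrD.
Qed.

Lemma vanishingZ k f : vanishing f -> vanishing (fun v => k * f v).
Proof.
by apply: (@vanishing_dom `|k|) => // v; rewrite normrM.
Qed.

Lemma vanishing_bounded f : vanishing f ->
  exists2 M : C, 0 <= M & forall v, `|f v| <= M.
Proof.
move=> /(_ 1 ltr01)/finite_fsetP[G GE].
have s0 : 0 <= \sum_(v <- G) `|f v| by rewrite sumr_ge0.
exists (1 + \sum_(v <- G) `|f v|); first by rewrite addr_ge0.
move=> v; have [f1|] := boolP (1 <= `|f v|).
  have vG : v \in G by have : [set` G] v by rewrite -GE.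
  rewrite (big_fsetD1 v)//= addrCA lerDl addr_ge0// sumr_ge0//.
rewrite -real_ltNge ?normr_real ?real1// => /ltW f1.
by apply: le_trans f1 _; rewrite lerDl.
Qed.

Lemma vanishing_unif f :
  (forall e, 0 < e -> exists2 g, vanishing g & forall v, `|f v - g v| <= e) ->
  vanishing f.
Proof.
move=> fg e e0; have e20 : 0 < e / 2 by rewrite divr_gt0.
have e40 : 0 < e / 2 / 2 by rewrite divr_gt0.
have [g vg fge] := fg _ e40.
apply: sub_finite_set (vg _ e20) => v /= ef.
apply: contraLR ef.
rewrite -!real_ltNge ?normr_real ?(gtr0_real e0) ?(gtr0_real e20)// => ge.
rewrite -[f v](subrK (g v)) (le_lt_trans (ler_normD _ _))//.
rewrite [e]splitr; apply: ler_ltD => //; apply: le_trans (fge v) _.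
by rewrite ler_pdivrMr// ler_peMr ?(ltW e20)// ler1n.
Qed.

End Vanishing.

Definition vanishing_pred (R : realType) (V : countType) : {pred V -> R[i]} :=
  fun f => `[< vanishing f >].

Lemma vanishing_submod (R : realType) (V : countType) :
  submod_closed (@vanishing_pred R V).
Proof.
split=> [|k f g /asboolP vf /asboolP vg]; apply/asboolP.
  move=> e e0; rewrite (_ : [set _ | _] = set0)//; apply/seteqP; split => // v.
  by rewrite /= normr0 => /(lt_le_trans e0); rewrite ltxx.
exact: vanishingD (vanishingZ k vf) vg.
Qed.

HB.instance Definition _ (R : realType) (V : countType) :=
  GRing.isSubmodClosed.Build R[i] (V -> R[i]) (@vanishing_pred R V)
    (@vanishing_submod R V).

Record c0 (R : realType) (V : countType) := C0 {
  c0_fun :> V -> R[i];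
  _ : vanishing_pred c0_fun }.

Section C0.
Variables (R : realType) (V : countType).
Local Notation C := R[i].
Local Notation c0 := (c0 R V).

HB.instance Definition _ := [isSub for @c0_fun R V].
HB.instance Definition _ := [Choice of c0 by <:].
HB.instance Definition _ := [SubChoice_isSubLmodule of c0 by <:].

Lemma c0_vanishing (f : c0) : vanishing f.
Proof. exact/asboolP/(valP f). Qed.

Lemma c0P (f g : c0) : (forall v, f v = g v) -> f = g.
Proof. by move=> fg; apply: val_inj; apply/funext. Qed.

Definition c0_norm (f : c0) : C := csup (range (fun v => `|f v|)).

Lemma c0_norm_le (f : c0) M : 0 <= M -> (forall v, `|f v| <= M) ->
  c0_norm f <= M.
Proof. by move=> M0 fM; apply: csup_le => // _ [v _ <-]; rewrite normr_ge0 fM. Qed.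

Lemma c0_norm_ub (f : c0) v : `|f v| <= c0_norm f.
Proof.
have [M M0 fM] := vanishing_bounded (c0_vanishing f).
by apply: (@csup_ub _ _ M) => [_ [w _ <-]|]; [rewrite normr_ge0 fM|exists v].
Qed.

Lemma c0_norm_ge0 (f : c0) : 0 <= c0_norm f.
Proof.
have [M M0 fM] := vanishing_bounded (c0_vanishing f).
by apply: (@csup_ge0 _ _ M) => _ [w _ <-]; rewrite normr_ge0 fM.
Qed.

Lemma c0_normD (f g : c0) : c0_norm (f + g) <= c0_norm f + c0_norm g.
Proof.
apply: c0_norm_le => [|v]; first by rewrite addr_ge0 ?c0_norm_ge0.
by rewrite (le_trans (ler_normD _ _))// lerD// c0_norm_ub.
Qed.

Lemma c0_normZ (k : C) (f : c0) : c0_norm (k *: f) = `|k| * c0_norm f.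
Proof.
have le l (g : c0) : c0_norm (l *: g) <= `|l| * c0_norm g.
  apply: c0_norm_le => [|v]; first by rewrite mulr_ge0 ?c0_norm_ge0.
  by rewrite normrM ler_wpM2l// c0_norm_ub.
apply/eqP; rewrite eq_le le/=; have [->|k0] := eqVneq k 0.
  by rewrite normr0 mul0r c0_norm_ge0.
rewrite mulrC -ler_pdivlMr ?normr_gt0// mulrC -normfV.
by apply: le_trans (le _ _); rewrite scalerA mulVf// scale1r.
Qed.

Lemma c0_norm_eq0 (f : c0) : c0_norm f = 0 -> f = 0.
Proof.
move=> f0; apply: c0P => v; apply/eqP; rewrite -normr_le0 -f0.
exact: c0_norm_ub.
Qed.

HB.instance Definition _ :=
  Lmodule_isNormed.Build C c0 c0_normD c0_normZ c0_norm_eq0.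

Lemma c0_normE (f : c0) : `|f| = c0_norm f. Proof. by []. Qed.

Lemma c0_complete (F : set_system c0) : ProperFilter F -> cauchy F -> cvg F.
Proof.
move=> FF /cauchy_small Fc.
have /choice[l lP] v : exists l : C, forall e : C, 0 < e ->
    F [set f | `|l - f v| < e].
  apply: C_complete => e /Fc[A FA Ae]; exists A => // f g Af Ag.
  exact: le_lt_trans (c0_norm_ub (f - g) v) (Ae _ _ Af Ag).
have H e : 0 < e -> exists2 A, F A & forall f, A f -> forall v, `|l v - f v| <= e.
  move=> e0; have e20 : 0 < e / 2 by rewrite divr_gt0.
  have [A FA Ae] := Fc _ e20; exists A => // f Af v.
  have [g [Ag gl]] := filter_ex (filterI FA (lP v _ e20)).
  rewrite -[l v](subrK (g v)) -addrA [e]splitr (le_trans (ler_normD _ _))//.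
  apply: lerD; first exact: ltW.
  exact: le_trans (c0_norm_ub (g - f) v) (ltW (Ae _ _ Ag Af)).
have lv : vanishing_pred l.
  apply/asboolP/vanishing_unif => e /H[A FA Al].
  have [f Af] := filter_ex FA; exists f; [exact: c0_vanishing|exact: Al].
apply: (@small_cvg _ _ _ _ (C0 lv)) => e e0; have [A FA Al] := H _ e0.
exists A => // f Af; apply: c0_norm_le => [|v]; [exact: ltW|exact: Al].
Qed.

HB.instance Definition _ := Uniform_isComplete.Build c0 c0_complete.

Lemma vanishingM (f g : c0) : vanishing_pred (fun v => f v * g v).
Proof.
apply/asboolP; have [M M0 fM] := vanishing_bounded (c0_vanishing f).
apply: (vanishing_dom M0 _ (c0_vanishing g)) => v.
by rewrite normrM ler_wpM2r.
Qed.

Lemma vanishing_conj (f : c0) : vanishing_pred (fun v => (f v)^*).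
Proof.
apply/asboolP; apply: (vanishing_dom ler01 _ (c0_vanishing f)) => v.
by rewrite norm_conjC mul1r.
Qed.

Definition c0_mul (f g : c0) : c0 := C0 (vanishingM f g).
Definition c0_star (f : c0) : c0 := C0 (vanishing_conj f).

Lemma c0_mulA : associative c0_mul.
Proof. by move=> f g h; apply: c0P => v /=; rewrite mulrA. Qed.

Lemma c0_mul_linearl g : linear (c0_mul ^~ g).
Proof. by move=> k f h; apply: c0P => v /=; rewrite mulrDl -mulrA. Qed.

Lemma c0_mul_linearr f : linear (c0_mul f).
Proof. by move=> k g h; apply: c0P => v /=; rewrite mulrDr mulrCA. Qed.

Lemma c0_starK : involutive c0_star.
Proof. by move=> f; apply: c0P => v /=; rewrite conjCK. Qed.

Lemma c0_star_conjlinear (k : C) (f g : c0) :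
  c0_star (k *: f + g) = k^* *: c0_star f + c0_star g.
Proof. by apply: c0P => v /=; rewrite rmorphD rmorphM. Qed.

Lemma c0_starM (f g : c0) :
  c0_star (c0_mul f g) = c0_mul (c0_star g) (c0_star f).
Proof. by apply: c0P => v /=; rewrite rmorphM mulrC. Qed.

Lemma c0_normM (f g : c0) : `|c0_mul f g| <= `|f| * `|g|.
Proof.
apply: c0_norm_le => [|v]; first by rewrite mulr_ge0.
by rewrite normrM ler_pM// c0_norm_ub.
Qed.

Lemma c0_norm_star (f : c0) : `|c0_mul (c0_star f) f| = `|f| ^+ 2.
Proof.
apply/eqP; rewrite eq_le; apply/andP; split.
  rewrite (le_trans (c0_normM _ _))// expr2 ler_wpM2r//.
  by apply: c0_norm_le => // v; rewrite norm_conjC c0_norm_ub.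
rewrite -[leRHS]sqrtCK ler_pXn2r ?nnegrE ?sqrtC_ge0//.
apply: c0_norm_le => [|v]; first by rewrite sqrtC_ge0.
rewrite -(@ler_pXn2r _ 2) ?nnegrE ?sqrtC_ge0// sqrtCK.
by apply: le_trans (c0_norm_ub _ v); rewrite /= normrM norm_conjC.
Qed.

Definition c0_alg : cstarAlgebra R := CStarAlgebra c0_mulA c0_mul_linearl
  c0_mul_linearr c0_starK c0_star_conjlinear c0_starM c0_normM c0_norm_star.

End C0.

(* [inner x x] is positive in A, i.e. of the form b^* b.  Definiteness of [inner]
   is a consequence of [hm_normE], as [`|x| = 0] implies [x = 0]; completeness
   for the norm of [hm_normE] is part of [completeNormedModType].  In the second
   variable [inner] is linear, hence by [inner_star] conjugate-linear in the
   first. *)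
Record hilbertModule (R : realType) (A : cstarAlgebra R) := HilbertModule {
  hm_sort :> completeNormedModType R[i];
  ract : hm_sort -> A -> hm_sort;
  inner : hm_sort -> hm_sort -> A;
  ract_linearl : forall a, linear (ract ^~ a);
  ract_linearr : forall x, linear (ract x);
  ractA : forall x a b, ract (ract x a) b = ract x (cmul a b);
  inner_linear : forall x, linear (inner x);
  inner_ract : forall x y a, inner x (ract y a) = cmul (inner x y) a;
  inner_star : forall x y, cstar (inner x y) = inner y x;
  inner_ge0 : forall x, exists b, inner x x = cmul (cstar b) b;
  hm_normE : forall x, `|x| = sqrtC `|inner x x| }.

(* S is adjointable with adjoint T; such maps are automatically linear, bounded
   and A-linear. *)
Definition adjoint_pair (R : realType) (A : cstarAlgebra R)
    (X : hilbertModule A) (S T : X -> X) : Prop :=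
  forall x y, inner (S x) y = inner x (T y).

(* By [lact_adjoint], [lact a] is an adjointable operator and [lact] maps the
   involution of A to the adjoint; with the other two axioms, [lact] is a
   *-homomorphism from A to the adjointable operators on the module. *)
Record correspondence (R : realType) (A : cstarAlgebra R) := Correspondence {
  corr_module :> hilbertModule A;
  lact : A -> corr_module -> corr_module;
  lact_adjoint : forall a, adjoint_pair (lact a) (lact (cstar a));
  lact_linear : forall x, linear (lact ^~ x);
  lactM : forall a b x, lact (cmul a b) x = lact a (lact b x) }.

Section CorrespondenceProperties.
Variables (R : realType) (A : cstarAlgebra R).
Implicit Types X Y : correspondence A.

(* The set is the linear span of the elements [lact a xi]. *)
Definition corr_nondegenerate X : Prop :=
  dense [set x : X | exists n (k : 'I_n -> R[i]) (a : 'I_n -> A) (xi : 'I_n -> X),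
    x = \sum_(i < n) k i *: lact (a i) (xi i)].

Definition corr_separable X : Prop :=
  exists2 D : set X, countable D & dense D.

Definition is_corr_morphism X Y (psi : X -> Y) : Prop :=
  [/\ linear psi,
      forall a b xi, psi (ract (lact a xi) b) = ract (lact a (psi xi)) b &
      forall xi eta, inner (psi xi) (psi eta) = inner xi eta].

Definition corr_isomorphic X Y : Prop :=
  exists2 psi : X -> Y, is_corr_morphism psi & bijective psi.

End CorrespondenceProperties.

Record digraph (V : countType) := Digraph {
  edge : countType;
  rng : edge -> V;
  src : edge -> V }.

Section Young.
Variable C : numClosedFieldType.
Implicit Types x y s : C.

Lemma young x y s : 0 < s ->
  `|x + y| ^+ 2 <= (1 + s) * `|x| ^+ 2 + (1 + s^-1) * `|y| ^+ 2.
Proof.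
move=> s0; apply: (@le_trans _ _ ((`|x| + `|y|) ^+ 2)).
  by rewrite ler_pXn2r ?nnegrE ?addr_ge0// ler_normD.
rewrite -subr_ge0.
rewrite [leRHS](_ : _ = (s * `|x| - `|y|) ^+ 2 / s); last first.
  by field; rewrite gt_eqF.
by rewrite divr_ge0 ?(ltW s0)// -realEsqr rpredB ?rpredM ?normr_real ?gtr0_real.
Qed.

Lemma young1 x y : `|x + y| ^+ 2 <= 2 * `|x| ^+ 2 + 2 * `|y| ^+ 2.
Proof. by have := young x y ltr01; rewrite invr1. Qed.

Lemma polar x y : x^* * y = 2^-1 * (`|x + y| ^+ 2 + (- 'i) * `|x + 'i * y| ^+ 2
  + ('i - 1) * (`|x| ^+ 2 + `|y| ^+ 2)).
Proof.
rewrite !normCK !rmorphD rmorphM/= conjCi.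
have i2 := @sqrCi C; move: 'i i2 => i i2.
move: (x^*) (y^*) => x' y'.
transitivity (2^-1 * (2 * (x' * y) + (i ^+ 2 + 1) * (x * y' - x' * y + i * y * y'))).
  by rewrite i2 addNr mul0r addr0 mulKf ?pnatr_eq0.
by congr (_ * _); ring.
Qed.
End Young.

Section GraphSpace.
Variables (R : realType) (V : countType) (E : digraph V).
Local Notation C := R[i].
Implicit Types (xi eta : edge E -> C) (v : V).

Definition fiber v : set (edge E) := [set e | src e = v].

(* The sums of |xi e|^2 over the edges with source v exist, and define a
   function of v that belongs to c_0(V). *)
Definition square_summable xi : Prop :=
  exists a : c0 R V, forall v, has_sum (fiber v) (fun e => `|xi e| ^+ 2) (a v).

Lemma square_summable_dom (c d : C) xi eta zeta :
    0 <= c -> 0 <= d ->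
    (forall e, `|zeta e| ^+ 2 <= c * `|xi e| ^+ 2 + d * `|eta e| ^+ 2) ->
  square_summable xi -> square_summable eta -> square_summable zeta.
Proof.
move=> k0 d0 le [a aP] [b bP].
have /choice[l lP] v : exists l : C,
    has_sum (fiber v) (fun e => `|zeta e| ^+ 2) l /\ 0 <= l <= c * a v + d * b v.
  have [|l sl lle] := @dom_has_sum _ _ (fiber v) (fun e => `|zeta e| ^+ 2) _ _ _
    (has_sumD (has_sumZ c (aP v)) (has_sumZ d (bP v))).
    by move=> e _; rewrite exprn_ge0//= le.
  by exists l.
have vl : vanishing_pred l.
  apply/asboolP; apply: (@vanishing_dom _ _ 1 _ (c *: a + d *: b)) => // [v|].
    have [_ /andP[l0 ll]] := lP v; rewrite mul1r (ger0_norm l0).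
    by rewrite (le_trans ll)// real_ler_norm// ger0_real// (le_trans l0 ll).
  exact: c0_vanishing.
by exists (C0 vl) => v; have [] := lP v.
Qed.

Definition square_summable_pred : {pred edge E -> C} :=
  fun xi => `[< square_summable xi >].

Lemma square_summable0 : square_summable (fun=> 0).
Proof.
exists 0 => v e e0; exists fset0 => [t /=|G _ _]; first by rewrite in_fset0.
rewrite big1; last by move=> t _; rewrite normr0 expr0n.
by rewrite subr0 [c0_fun _ _](_ : _ = 0)// normr0.
Qed.

Lemma square_summable_mul (h : edge E -> C) (M : C) xi :
  (forall e, `|h e| <= M) -> square_summable xi ->
  square_summable (fun e => h e * xi e).
Proof.
move=> hM sxi.
have [[e0]|nE] := pselect (inhabited (edge E)); last first.
  apply: (square_summable_dom ler01 ler01 _ sxi sxi) => e.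
  by exfalso; apply: nE; exists.
have M0 : 0 <= M by apply: le_trans (hM e0).
apply: (square_summable_dom (exprn_ge0 2 M0) (lexx 0) _ sxi sxi) => e.
rewrite mul0r addr0 normrM exprMn ler_wpM2r ?exprn_ge0//.
by rewrite ler_pXn2r ?nnegrE.
Qed.

Lemma square_summable_submod : submod_closed square_summable_pred.
Proof.
split=> [|k xi eta /asboolP sxi /asboolP seta]; apply/asboolP.
  exact: square_summable0.
have skxi := square_summable_mul (fun=> lexx `|k|) sxi.
apply: (square_summable_dom (ler0n _ 2) (ler0n _ 2) _ skxi seta) => e.
exact: young1.
Qed.

HB.instance Definition _ := GRing.isSubmodClosed.Build C (edge E -> C)
  square_summable_pred square_summable_submod.

Record graph_space := GraphSpace {
  gs_fun :> edge E -> C;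
  _ : square_summable_pred gs_fun }.

HB.instance Definition _ := [isSub for gs_fun].
HB.instance Definition _ := [Choice of graph_space by <:].
HB.instance Definition _ := [SubChoice_isSubLmodule of graph_space by <:].

Implicit Types f g h : graph_space.

Lemma gs_square_summable f : square_summable f.
Proof. exact/asboolP/(valP f). Qed.

Lemma gsP f g : (forall e, f e = g e) -> f = g.
Proof. by move=> fg; apply: val_inj; apply/funext. Qed.

Lemma gs_inner_ex f g : exists a : c0 R V,
  forall v, has_sum (fiber v) (fun e => (f e)^* * g e) (a v).
Proof.
have [a aP] := gs_square_summable f; have [b bP] := gs_square_summable g.
have [c cP] := gs_square_summable (f + g).
have [d dP] := gs_square_summable (f + 'i *: g).
exists (2^-1 *: (c + (- 'i) *: d + ('i - 1) *: (a + b))) => v.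
apply: has_sum_eq (has_sumZ 2^-1 (has_sumD (has_sumD (cP v)
  (has_sumZ (- 'i) (dP v))) (has_sumZ ('i - 1) (has_sumD (aP v) (bP v))))).
by move=> e _; rewrite [RHS]polar.
Qed.

Definition gs_inner_fun f g (v : V) : C :=
  csum (fiber v) (fun e => (f e)^* * g e).

Lemma gs_inner_vanishing f g : vanishing_pred (gs_inner_fun f g).
Proof.
have [a aP] := gs_inner_ex f g.
rewrite (_ : gs_inner_fun f g = a); first exact: (valP a).
by apply/funext => v; exact: csumE.
Qed.

Definition gs_inner f g : c0 R V := C0 (gs_inner_vanishing f g).

Lemma gs_inner_sum f g v :
  has_sum (fiber v) (fun e => (f e)^* * g e) (gs_inner f g v).
Proof.
by have [a aP] := gs_inner_ex f g; rewrite /= /gs_inner_fun (csumE (aP v)).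
Qed.

Lemma gs_inner_sqr f v :
  has_sum (fiber v) (fun e => `|f e| ^+ 2) (gs_inner f f v).
Proof. by apply: has_sum_eq (gs_inner_sum f f v) => e _; rewrite normCKC. Qed.

Lemma gs_inner_linear f : linear (gs_inner f).
Proof.
move=> k g h; apply: c0P => v; apply: csumE.
apply: has_sum_eq (has_sumD (has_sumZ k (gs_inner_sum f g v)) (gs_inner_sum f h v)).
by move=> e _ /=; rewrite mulrDr mulrCA.
Qed.

Lemma gs_inner_star f g : c0_star (gs_inner f g) = gs_inner g f.
Proof.
apply: c0P => v; apply/esym/csumE.
apply: has_sum_eq (has_sum_conj (gs_inner_sum f g v)).
by move=> e _ /=; rewrite rmorphM/= conjCK mulrC.
Qed.

Lemma gs_inner_pt_ge0 f v : 0 <= gs_inner f f v.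
Proof. by apply: nneg_has_sum_ge0 (gs_inner_sqr f v) => e _; exact: exprn_ge0. Qed.

Lemma gs_inner_ge0 f : exists b, gs_inner f f = c0_mul (c0_star b) b.
Proof.
have sv : vanishing_pred (fun v => sqrtC (gs_inner f f v)).
  apply/asboolP => e e0.
  apply: sub_finite_set (c0_vanishing (gs_inner f f) (exprn_gt0 2 e0)) => v /=.
  rewrite ger0_norm ?sqrtC_ge0 ?gs_inner_pt_ge0// => le.
  rewrite ger0_norm ?gs_inner_pt_ge0// -[leRHS]sqrtCK.
  by rewrite ler_pXn2r ?nnegrE ?sqrtC_ge0 ?gs_inner_pt_ge0// ltW.
exists (C0 sv); apply: c0P => v; rewrite /= -normCKC ger0_norm ?sqrtCK//.
by rewrite sqrtC_ge0 gs_inner_pt_ge0.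
Qed.

Definition gs_norm f : C := sqrtC `|gs_inner f f|.

Lemma gs_norm_ge0 f : 0 <= gs_norm f. Proof. by rewrite sqrtC_ge0. Qed.

Lemma gs_norm_le f M : 0 <= M -> (forall v, gs_inner f f v <= M ^+ 2) ->
  gs_norm f <= M.
Proof.
move=> M0 fM; rewrite -(@ler_pXn2r _ 2) ?nnegrE ?gs_norm_ge0// sqrtCK.
apply: c0_norm_le => [|v]; first exact: exprn_ge0.
by rewrite ger0_norm ?gs_inner_pt_ge0.
Qed.

Lemma gs_norm_ub f v : gs_inner f f v <= gs_norm f ^+ 2.
Proof.
by rewrite sqrtCK -[leLHS]ger0_norm ?gs_inner_pt_ge0// c0_norm_ub.
Qed.

Lemma gs_sum_ub f v (G : {fset edge E}) : [set` G] `<=` fiber v ->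
  \sum_(e <- G) `|f e| ^+ 2 <= gs_norm f ^+ 2.
Proof.
move=> Gv; apply: le_trans (gs_norm_ub f v).
apply: (nneg_has_sum _ (gs_inner_sqr f v)).1 => // e _; exact: exprn_ge0.
Qed.

Lemma gs_pt_ub f e : `|f e| <= gs_norm f.
Proof.
rewrite -(@ler_pXn2r _ 2) ?nnegrE ?gs_norm_ge0//.
have := @gs_sum_ub f (src e) [fset e]%fset; rewrite big_seq_fset1; apply.
by move=> t /=; rewrite in_fset1 => /eqP ->.
Qed.

Lemma gs_norm_eq0 f : gs_norm f = 0 -> f = 0.
Proof.
move=> f0; apply: gsP => e; apply/eqP.
by rewrite -normr_le0 -f0 gs_pt_ub.
Qed.

Lemma gs_normD f g : gs_norm (f + g) <= gs_norm f + gs_norm g.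
Proof.
have [f0|f0] := eqVneq (gs_norm f) 0.
  by rewrite f0 (gs_norm_eq0 f0) !add0r.
have [g0|g0] := eqVneq (gs_norm g) 0.
  by rewrite g0 (gs_norm_eq0 g0) !addr0.
have {}f0 : 0 < gs_norm f by rewrite lt_def f0 gs_norm_ge0.
have {}g0 : 0 < gs_norm g by rewrite lt_def g0 gs_norm_ge0.
apply: gs_norm_le => [|v]; first by rewrite addr_ge0 ?ltW.
have s0 : 0 < gs_norm g / gs_norm f by rewrite divr_gt0.
have := le_has_sum _ (gs_inner_sqr (f + g) v) (has_sumD
  (has_sumZ (1 + gs_norm g / gs_norm f) (gs_inner_sqr f v))
  (has_sumZ (1 + (gs_norm g / gs_norm f)^-1) (gs_inner_sqr g v))).
move=> /(_ _)/le_trans; apply => [e _|].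
  by rewrite exprn_ge0//= young.
rewrite [leRHS](_ : _ = (1 + gs_norm g / gs_norm f) * gs_norm f ^+ 2 +
  (1 + (gs_norm g / gs_norm f)^-1) * gs_norm g ^+ 2); last first.
  by field; rewrite !gt_eqF.
by apply: lerD; rewrite ler_wpM2l ?gs_norm_ub// addr_ge0// ltW// invr_gt0.
Qed.

Lemma gs_normZ (k : C) f : gs_norm (k *: f) = `|k| * gs_norm f.
Proof.
rewrite /gs_norm (_ : gs_inner (k *: f) (k *: f) = (`|k| ^+ 2) *: gs_inner f f).
  by rewrite normrZ normrX normr_id rootCMl ?exprn_ge0// sqrCK.
apply: c0P => v; apply: csumE.
apply: has_sum_eq (has_sumZ _ (gs_inner_sum f f v)) => e _ /=.
by rewrite normCKC rmorphM/= mulrACA.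
Qed.

HB.instance Definition _ :=
  Lmodule_isNormed.Build C graph_space gs_normD gs_normZ gs_norm_eq0.

Lemma gs_complete (F : set_system graph_space) :
  ProperFilter F -> cauchy F -> cvg F.
Proof.
move=> FF /cauchy_small Fc.
have /choice[l lP] e : exists l : C, forall d : C, 0 < d ->
    F [set f : graph_space | `|l - f e| < d].
  apply: C_complete => d /Fc[A FA Ad]; exists A => // f g Af Ag.
  exact: le_lt_trans (gs_pt_ub (f - g) e) (Ad _ _ Af Ag).
have H d : 0 < d -> exists2 A, F A & forall f, A f -> forall v (G : {fset edge E}),
    [set` G] `<=` fiber v -> \sum_(e <- G) `|l e - f e| ^+ 2 <= d ^+ 2.
  move=> d0; have d20 : 0 < d / 2 by rewrite divr_gt0.
  have [A FA Ad] := Fc _ d20; exists A => // f Af v G Gv.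
  pose m : C := (#|` G|)%:R.
  have m0 : 0 < m + 1 by rewrite ltr_wpDl// ler0n.
  have dm0 : 0 < d / 2 / (m + 1) by rewrite divr_gt0.
  have FG : F [set g : graph_space | forall e, e \in G -> `|l e - g e| < d / 2 / (m + 1)].
    have : F (\bigcap_(e in [set` G]) [set g : graph_space | `|l e - g e| < d / 2 / (m + 1)]).
      by apply: filter_bigI => e _; exact: lP.
    by apply: filterS => g gG e eG; exact: gG.
  have [g [Ag gl]] := filter_ex (filterI FA FG).
  apply: (@le_trans _ _ (2 * (\sum_(e <- G) `|l e - g e| ^+ 2) +
    2 * (\sum_(e <- G) `|(g - f) e| ^+ 2))).
    rewrite !mulr_sumr -big_split/= ler_sum// => e _.
    by rewrite -[l e](subrK (g e)) -addrA subrK; exact: young1.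
  rewrite (_ : d ^+ 2 = 2 * (d / 2) ^+ 2 + 2 * (d / 2) ^+ 2); last first.
    by field.
  apply: lerD; rewrite ler_wpM2l//; last first.
    apply: le_trans (gs_sum_ub (g - f) Gv) _.
    by rewrite ler_pXn2r ?nnegrE ?gs_norm_ge0 ?(ltW d20)// ltW// Ad.
  apply: (@le_trans _ _ (\sum_(e <- G) (d / 2 / (m + 1)) ^+ 2)).
    rewrite big_seq [leRHS]big_seq ler_sum// => e /gl le.
    by rewrite ler_pXn2r ?nnegrE ?(ltW dm0)// ltW.
  rewrite big_const_seq count_predT iter_addr_0 -[leLHS]mulr_natr.
  rewrite exprMn -mulrA ler_piMr ?exprn_ge0 ?(ltW d20)//.
  rewrite exprVn mulrC ler_pdivrMr ?exprn_gt0// mul1r -/m.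
  have m1 : 0 <= m by rewrite ler0n.
  by rewrite expr2 mulrDr mulr1 -[leLHS]add0r lerD ?mulr_ge0 ?lerDl// addr_ge0.
have sl : square_summable_pred l.
  have B d : 0 < d -> exists f, forall v (G : {fset edge E}),
      [set` G] `<=` fiber v ->
      \sum_(e <- G) `|l e| ^+ 2 <= 2 * d ^+ 2 + 2 * gs_inner f f v.
    move=> d0; have [A FA Ad] := H _ d0; have [f Af] := filter_ex FA.
    exists f => v G Gv.
    apply: (@le_trans _ _ (2 * (\sum_(e <- G) `|l e - f e| ^+ 2) +
      2 * (\sum_(e <- G) `|f e| ^+ 2))).
      rewrite !mulr_sumr -big_split/= ler_sum// => e _.
      by rewrite -{1}[l e](subrK (f e)); exact: young1.
    apply: lerD; rewrite ler_wpM2l//; first exact: (Ad _ _ v).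
    by apply: (nneg_has_sum _ (gs_inner_sqr f v)).1 => // e _; exact: exprn_ge0.
  have /choice[n nP] v : exists n : C,
      has_sum (fiber v) (fun e => `|l e| ^+ 2) n.
    have [f fB] := B 1 ltr01.
    by have [|n [? _ _]] := nneg_sum _ (fB v); [move=> e _; exact: exprn_ge0|exists n].
  have n0 v : 0 <= n v.
    by apply: nneg_has_sum_ge0 (nP v) => e _; exact: exprn_ge0.
  have vn : vanishing_pred n.
    apply/asboolP => e e0.
    have d0 : 0 < sqrtC (e / 4) by rewrite sqrtC_gt0 divr_gt0.
    have [f fB] := B _ d0.
    have e40 : 0 < e / 4 by rewrite divr_gt0.
    apply: sub_finite_set (c0_vanishing (gs_inner f f) e40) => v /=.
    rewrite !ger0_norm ?n0 ?gs_inner_pt_ge0// => en.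
    have := (nneg_has_sum _ (nP v)).2 _ (fB v).
    rewrite sqrtCK => /(_ _)/(le_trans en) le.
    have {}le : e <= 2 * (e / 4) + 2 * gs_inner f f v.
      by apply: le => t _; exact: exprn_ge0.
    rewrite -(@ler_pM2l _ 2)// -(lerD2l (2 * (e / 4))); apply: le_trans le.
    rewrite [leLHS](_ : _ = e)//.
    by field.
  by apply/asboolP; exists (C0 vn).
apply: (@small_cvg _ _ _ _ (GraphSpace sl)) => d d0.
have [A FA Al] := H _ d0; exists A => // f Af.
apply: gs_norm_le => [|v]; first exact: ltW.
apply: (nneg_has_sum _ (gs_inner_sqr _ v)).2 => [e _|G Gv].
  exact: exprn_ge0.
exact: (Al f Af v G Gv).
Qed.

HB.instance Definition _ := Uniform_isComplete.Build graph_space gs_complete.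

Lemma lact_square_summable (a : c0 R V) f :
  square_summable_pred (fun e => a (rng e) * f e).
Proof.
have [M M0 aM] := vanishing_bounded (c0_vanishing a).
by apply/asboolP/(@square_summable_mul _ M)/gs_square_summable => e; exact: aM.
Qed.

Lemma ract_square_summable f (b : c0 R V) :
  square_summable_pred (fun e => f e * b (src e)).
Proof.
have [M M0 bM] := vanishing_bounded (c0_vanishing b).
under [X in square_summable_pred X]eq_fun do rewrite mulrC.
by apply/asboolP/(@square_summable_mul _ M)/gs_square_summable => e; exact: bM.
Qed.

Definition gs_lact (a : c0_alg R V) f : graph_space :=
  GraphSpace (lact_square_summable a f).

Definition gs_ract f (b : c0_alg R V) : graph_space :=
  GraphSpace (ract_square_summable f b).

Lemma gs_ract_linearl b : linear (gs_ract ^~ b).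
Proof. by move=> k f g; apply: gsP => e /=; rewrite mulrDl -mulrA. Qed.

Lemma gs_ract_linearr f : linear (gs_ract f).
Proof. by move=> k a b; apply: gsP => e /=; rewrite mulrDr mulrCA. Qed.

Lemma gs_ractA f a b : gs_ract (gs_ract f a) b = gs_ract f (cmul a b).
Proof. by apply: gsP => e /=; rewrite mulrA. Qed.

Lemma gs_inner_ract f g a : gs_inner f (gs_ract g a) = c0_mul (gs_inner f g) a.
Proof.
apply: c0P => v; apply: csumE; rewrite [c0_fun _ _]mulrC.
apply: has_sum_eq (has_sumZ (a v) (gs_inner_sum f g v)) => e /= <-.
by rewrite mulrC mulrA.
Qed.

Definition graph_hilbertModule : hilbertModule (c0_alg R V) :=
  @HilbertModule R (c0_alg R V) graph_space gs_ract gs_inner gs_ract_linearl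
    gs_ract_linearr gs_ractA gs_inner_linear gs_inner_ract gs_inner_star
    gs_inner_ge0 (fun=> erefl).

Lemma gs_lact_adjoint (a : c0_alg R V) :
  @adjoint_pair R (c0_alg R V) graph_hilbertModule (gs_lact a) (gs_lact (cstar a)).
Proof.
move=> f g; apply: c0P => v; apply: csumE.
apply: has_sum_eq (gs_inner_sum f (gs_lact (cstar a) g) v) => e _ /=.
by rewrite rmorphM/= mulrA [_^* * _^*]mulrC.
Qed.

Lemma gs_lact_linear f : linear (gs_lact ^~ f).
Proof. by move=> k a b; apply: gsP => e /=; rewrite mulrDl -mulrA. Qed.

Lemma gs_lactM a b f : gs_lact (cmul a b) f = gs_lact a (gs_lact b f).
Proof. by apply: gsP => e /=; rewrite mulrA. Qed.

Definition graph_correspondence : correspondence (c0_alg R V) :=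
  @Correspondence R (c0_alg R V) graph_hilbertModule gs_lact gs_lact_adjoint
    gs_lact_linear gs_lactM.

End GraphSpace.

(* Main.v *)
(* A correspondence X over c_0(V) splits into the Hilbert spaces
   delta_w . X . delta_v.  A maximal orthonormal family B of vectors taken from
   these blocks is countable by separability; its elements, placed in
   delta_w . X . delta_v, are the edges from v to w.  The isomorphism sends x to
   its Fourier coefficients e |-> <e, x>(v).  They are square summable by
   Bessel's inequality, every square summable family is the family of coefficients of a
   convergent sum, and by maximality of B (and nondegeneracy) a vector with zero
   coefficients is zero; Parseval's identity and polarization follow. *)
Require Import Defs.
From mathcomp Require Import all_boot all_order all_algebra.
From mathcomp Require Import all_classical all_reals all_analysis.
From mathcomp Require Import finmap complex ring summability.
Set Implicit Arguments.
Unset Strict Implicit.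
Unset Printing Implicit Defensive.
Import Order.TTheory GRing.Theory Num.Theory numFieldNormedType.Exports.
Local Open Scope classical_set_scope.
Local Open Scope ring_scope.

Lemma dense_near (K : numFieldType) (M : normedModType K) (S : set M) :
  dense S -> forall x (e : K), 0 < e -> exists2 y, S y & `|x - y| < e.
Proof.
move=> dS x e e0.
have [|y []] := dS (ball x e) _ (ball_open x e).
  by exists x; exact: ballxx.
by rewrite -ball_normE => xy Sy; exists y.
Qed.

(** * Pointwise inner products, and the action of [delta w] on a correspondence *)

Section PointInner.
Variables (R : realType) (V : countType).
Local Notation C := R[i].

Lemma delta_vanishing (w : V) :
  vanishing_pred (fun v => (v == w)%:R : C).
Proof.
apply/asboolP => e e0; apply: sub_finite_set (finite_set1 w) => v /=.
case: eqVneq => //= _; rewrite normr0 => /(lt_le_trans e0).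
by rewrite ltxx.
Qed.

Definition delta (w : V) : c0_alg R V := C0 (delta_vanishing w).

Lemma deltaE w v : (delta w : c0 R V) v = (v == w)%:R. Proof. by []. Qed.

Lemma delta_idem w : cmul (delta w) (delta w) = delta w.
Proof. by apply: c0P => v /=; rewrite -natrM mulnb andbb. Qed.

Lemma delta_star w : cstar (delta w) = delta w.
Proof. by apply: c0P => v /=; rewrite conjC_nat. Qed.

Lemma c0_sumE I (s : seq I) (F : I -> c0 R V) v :
  (\sum_(i <- s) F i : c0 R V) v = \sum_(i <- s) F i v.
Proof.
by elim: s => [|i s IH]; rewrite ?big_nil// !big_cons -IH.
Qed.

Variable X : correspondence (c0_alg R V).
Implicit Types (x y z : X) (a b : c0_alg R V) (v w : V) (k : C).

(** For fixed [v] this is a positive semidefinite sesquilinear form, so Hilbert space arguments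
    apply one point at a time. *)
Definition ip x y v : C := (inner x y : c0 R V) v.

Lemma ip_linear x k y z v : ip x (k *: y + z) v = k * ip x y v + ip x z v.
Proof. by rewrite /ip inner_linear. Qed.

Lemma ipDr x y z v : ip x (y + z) v = ip x y v + ip x z v.
Proof. by rewrite -[y]scale1r ip_linear mul1r scale1r. Qed.

Lemma ip0r x v : ip x 0 v = 0.
Proof. by apply: (@addrI _ (ip x 0 v)); rewrite -ipDr !addr0. Qed.

Lemma ipZr x k y v : ip x (k *: y) v = k * ip x y v.
Proof. by rewrite -[k *: y]addr0 ip_linear ip0r addr0. Qed.

Lemma ipBr x y z v : ip x (y - z) v = ip x y v - ip x z v.
Proof. by rewrite -scaleN1r ipDr ipZr mulN1r. Qed.

Lemma ip_sumr I (s : seq I) x (F : I -> X) v :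
  ip x (\sum_(i <- s) F i) v = \sum_(i <- s) ip x (F i) v.
Proof.
elim: s => [|i s IH]; first by rewrite !big_nil ip0r.
by rewrite !big_cons ipDr IH.
Qed.

Lemma ip_conj x y v : (ip x y v)^* = ip y x v.
Proof. by rewrite /ip -(inner_star x y). Qed.

Lemma ipBl x y z v : ip (x - y) z v = ip x z v - ip y z v.
Proof. by rewrite -ip_conj ipBr rmorphB /= !ip_conj. Qed.

Lemma ipZl k x y v : ip (k *: x) y v = k^* * ip x y v.
Proof. by rewrite -ip_conj ipZr rmorphM /= !ip_conj. Qed.

Lemma ip_suml I (s : seq I) x (F : I -> X) v :
  ip (\sum_(i <- s) F i) x v = \sum_(i <- s) ip (F i) x v.
Proof.
rewrite -ip_conj ip_sumr rmorph_sum; apply: eq_bigr => i _.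
exact: ip_conj.
Qed.

Lemma ip_ractr x y a v : ip x (ract y a) v = ip x y v * (a : c0 R V) v.
Proof. by rewrite /ip inner_ract. Qed.

Lemma ip_ractl x y a v : ip (ract x a) y v = ((a : c0 R V) v)^* * ip x y v.
Proof. by rewrite -ip_conj ip_ractr rmorphM /= ip_conj mulrC. Qed.

Lemma ip_lact x y a v : ip (lact a x) y v = ip x (lact (cstar a) y) v.
Proof. by rewrite /ip lact_adjoint. Qed.

Lemma ip_ge0 x v : 0 <= ip x x v.
Proof.
rewrite /ip; have [b ->] := inner_ge0 x.
by rewrite [c0_fun _ _]mulrC mul_conjC_ge0.
Qed.

Lemma normr_sqrE x : `|x| ^+ 2 = `|inner x x|.
Proof. by rewrite hm_normE sqrtCK. Qed.

Lemma normr_ipP x M : 0 <= M ->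
  reflect (forall v, ip x x v <= M ^+ 2) (`|x| <= M).
Proof.
move=> M0; rewrite -(@ler_pXn2r _ 2) ?nnegrE// normr_sqrE.
apply: (iffP idP) => [le v|le].
  apply: le_trans le; rewrite -[leLHS]ger0_norm ?ip_ge0//.
  exact: c0_norm_ub.
apply: c0_norm_le => [|v]; first exact: exprn_ge0.
by rewrite ger0_norm ?ip_ge0// le.
Qed.

Lemma ip_le_norm x v : ip x x v <= `|x| ^+ 2.
Proof. by move: v; apply/normr_ipP. Qed.

Lemma ip_eq0 x : (forall v, ip x x v = 0) -> x = 0.
Proof.
move=> x0; apply/eqP; rewrite -normr_le0; apply/normr_ipP => // v.
by rewrite x0 expr0n.
Qed.

Lemma ip_sep x y : (forall z v, ip z x v = ip z y v) -> x = y.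
Proof.
move=> xy; apply/eqP; rewrite -subr_eq0; apply/eqP/ip_eq0 => v.
by rewrite ipBr xy subrr.
Qed.

(** Linearity of [lact a] is not an axiom: moving [lact a] across the inner product reduces it to
    linearity of [ip], and [ip_sep] concludes. *)
Lemma lactZr a k x : lact a (k *: x) = k *: lact a x.
Proof.
apply: ip_sep => z v.
by rewrite -[a]cstarK -ip_lact !ipZr ip_lact.
Qed.

Lemma lact_ract a x b : lact a (ract x b) = ract (lact a x) b.
Proof.
apply: ip_sep => z v.
by rewrite -[a]cstarK -ip_lact !ip_ractr ip_lact.
Qed.

Lemma lactD a b x : lact (a + b) x = lact a x + lact b x.
Proof. by have := lact_linear x 1 a b; rewrite !scale1r. Qed.

Lemma lact0 x : lact 0 x = 0.
Proof. by apply: (@addrI _ (lact 0 x)); rewrite -lactD !addr0. Qed.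

Lemma lactZl k a x : lact (k *: a) x = k *: lact a x.
Proof. by rewrite -[k *: a]addr0 lact_linear lact0 addr0. Qed.

Lemma lactB a b x : lact (a - b) x = lact a x - lact b x.
Proof. by rewrite -scaleN1r lactD lactZl scaleN1r. Qed.

Lemma lact_sum I (s : seq I) (F : I -> c0_alg R V) x :
  lact (\sum_(i <- s) F i) x = \sum_(i <- s) lact (F i) x.
Proof.
elim: s => [|i s IH]; first by rewrite !big_nil lact0.
by rewrite !big_cons lactD IH.
Qed.

(* [c0 V] has no unit, so [1 - a^* a] is realised as the square of
   [1 - lact u], where [1 - u = sqrt (1 - |a|^2)]. *)
Lemma lact_contraction a x v : (forall w, `|(a : c0 R V) w| <= 1) ->
  ip (lact a x) (lact a x) v <= ip x x v.
Proof.
move=> a1.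
have s0 w : 0 <= 1 - `|(a : c0 R V) w| ^+ 2 by rewrite subr_ge0 exprn_ile1.
have uv : vanishing_pred (fun w => 1 - sqrtC (1 - `|(a : c0 R V) w| ^+ 2)).
  (* Domination by [|a|]: for [0 <= t <= 1], [1 - sqrt (1 - t^2) <= t], because [1 - t^2] exceeds
     [(1 - t)^2] by [2 t (1 - t)]. *)
  apply/asboolP/(vanishing_dom ler01 _ (c0_vanishing a)) => w.
  have t1 := a1 w; have t0 := normr_ge0 ((a : c0 R V) w); have := s0 w.
  move: t0 t1; set t := `|_|; move=> t0 t1 st0 /=; rewrite mul1r ger0_norm.
    rewrite lerBlDr -lerBlDl -(@ler_pXn2r _ 2) ?nnegrE ?sqrtC_ge0 ?st0//;
      last by rewrite subr_ge0.
    rewrite sqrtCK -subr_ge0 (_ : _ - _ = 2 * t * (1 - t)); last by ring.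
    by rewrite !mulr_ge0// subr_ge0.
  rewrite subr_ge0 -(@ler_pXn2r _ 2) ?nnegrE ?sqrtC_ge0// sqrtCK expr1n.
  by rewrite gerBl exprn_ge0.
pose u : c0_alg R V := C0 uv.
have uS : cstar u = u.
  apply: c0P => w /=; rewrite rmorphB rmorph1 /= geC0_conj//.
  by rewrite sqrtC_ge0.
have uE : cmul (cstar a) a = u + u - cmul u u.
  apply: c0P => w; transitivity (`|(a : c0 R V) w| ^+ 2).
    by rewrite normCKC.
  rewrite -[LHS](subKr 1) -[X in _ - X = _]sqrtCK.
  transitivity (u w + u w - u w * u w); last by [].
  by rewrite /=; ring.
have := ip_ge0 (x - lact u x) v.
rewrite !(ipBr, ipBl) !ip_lact uS -!lactM uE lactB lactD.
rewrite !(ipBr, ipDr).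
move=> h; rewrite -subr_ge0; move: h; congr (is_true (0 <= _)).
ring.
Qed.

(** Every [b] is a uniform limit of finite combinations of the [delta w], which kill [x]; hence [b]
    kills [x]. Then [x] is orthogonal to all [lact a z], whose span is dense. *)
Lemma delta_total x : corr_nondegenerate X ->
  (forall w, lact (delta w) x = 0) -> x = 0.
Proof.
move=> nd x0.
have lx b : lact b x = 0.
  apply: ip_eq0 => v; apply/eqP; rewrite eq_le ip_ge0 andbT.
  apply/ler_addgt0Pl => e e0; rewrite addr0.
  (* Chosen so that [d^2 (ip x x v + 1) = e]; the [+ 1] keeps the denominator positive. *)
  have d0 : 0 < sqrtC (e / (ip x x v + 1)).
    by rewrite sqrtC_gt0 divr_gt0// ltr_wpDl// ip_ge0.
  set d := sqrtC _ in d0.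
  have /finite_fsetP[F FE] := c0_vanishing b d0.
  (* [c] is [b] with its finitely many values of modulus at least [d] erased, so [|c| <= d], and
     [d^-1 *: c] acts as a contraction. *)
  pose c : c0_alg R V := b - \sum_(w <- F) (b : c0 R V) w *: delta w.
  have cE : lact b x = lact c x.
    rewrite /c lactB lact_sum big1 ?subr0// => w _.
    by rewrite lactZl x0 scaler0.
  have cd w : `|(c : c0 R V) w| <= d.
    have -> : (c : c0 R V) w =
        (b : c0 R V) w - \sum_(t <- F) (b : c0 R V) t * (w == t)%:R.
      by rewrite -(c0_sumE F (fun t => (b : c0 R V) t *: delta t)).
    have [wF|wF] := boolP (w \in F).
      rewrite (big_fsetD1 w)//= eqxx mulr1 big_seq big1.
        by rewrite addr0 subrr normr0 ltW.
      by move=> t; rewrite in_fsetD1 eq_sym => /andP[/negPf-> _]; rewrite mulr0.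
    rewrite big_seq big1 ?subr0 => [|t tF]; last first.
      by case: eqVneq wF => [->|]; rewrite ?tF// mulr0.
    rewrite ltW// real_ltNge ?normr_real ?gtr0_real//; apply: contra wF => dw.
    by have : [set` F] w by rewrite -FE.
  have -> : lact b x = d *: lact (d^-1 *: c) x.
    by rewrite cE lactZl scalerA divff ?scale1r// gt_eqF.
  rewrite ipZr ipZl mulrA -normCK (ger0_norm (ltW d0)) sqrtCK.
  have : ip (lact (d^-1 *: c) x) (lact (d^-1 *: c) x) v <= ip x x v.
    apply: lact_contraction => w.
    rewrite [c0_fun _ _](_ : _ = d^-1 * (c : c0 R V) w)// normrM normfV.
    by rewrite (ger0_norm (ltW d0)) mulrC ler_pdivrMr// mul1r.
  move=> le; rewrite mulrAC ler_pdivrMr ?ltr_wpDl ?ip_ge0//.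
  by rewrite ler_pM2l// (le_trans le)// lerDl.
apply/eqP; rewrite -normr_le0; apply/negPn/negP => nx.
have x_gt0 : 0 < `|x| by rewrite real_ltNge ?normr_real.
(* A [y] in the span closer to [x] than [|x|] contradicts Pythagoras, since [x] is orthogonal to
   [y]. *)
have [y [n [k [a [z yE]]]] /lt_geF/negP] := dense_near nd x x_gt0; apply.
apply/normr_ipP => // v; apply: le_trans (ip_le_norm _ v).
have yx : ip x y v = 0.
  rewrite yE ip_sumr big1// => i _; rewrite ipZr -[a i]cstarK -ip_lact lx.
  by rewrite -ip_conj ip0r conjC0 mulr0.
rewrite !(ipBr, ipBl) yx -(ip_conj x y) yx conjC0 subr0 sub0r opprK.
by rewrite lerDl ip_ge0.
Qed.

End PointInner.

(** * Fourier expansion along a total orthonormal family indexed by edges *)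

Section OrthonormalFamily.
Variables (R : realType) (V : countType) (X : correspondence (c0_alg R V)).
Variables (E : digraph V) (el : edge E -> X).
Local Notation C := R[i].
Hypothesis el_lact : forall e a, lact a (el e) = (a : c0 R V) (rng e) *: el e.
Hypothesis el_ract : forall e a, ract (el e) a = (a : c0 R V) (src e) *: el e.
Hypothesis el_ip : forall e e' v,
  ip (el e) (el e') v = ((e == e') && (src e == v))%:R.
Hypothesis el_total : forall x, (forall e, ip (el e) x (src e) = 0) -> x = 0.
Implicit Types (x y : X) (e : edge E) (v : V) (f : edge E -> C)
  (K : {fset edge E}) (d : C).

Definition coef x e : C := ip (el e) x (src e).

Definition sumel f K : X := \sum_(e <- K) f e *: el e.

(** [el e] absorbs [delta (src e)] on the right, so its inner products live at the single point
    [src e]. *)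
Lemma el_ip_src e x v : ip (el e) x v = (src e == v)%:R * coef x e.
Proof.
have -> : ip (el e) x v = (src e == v)%:R * ip (el e) x v.
  have := el_ract e (delta R (src e)); rewrite deltaE eqxx scale1r => {1}<-.
  by rewrite ip_ractl deltaE conjC_nat eq_sym.
by case: eqVneq => [<-|_]; rewrite ?mul0r.
Qed.

Lemma ip_sumel f K x v :
  ip (sumel f K) x v = \sum_(e <- K | src e == v) (f e)^* * coef x e.
Proof.
rewrite ip_suml [RHS]big_mkcond; apply: eq_bigr => e _.
by rewrite ipZl el_ip_src; case: eqP => _; rewrite ?mul1r// mul0r mulr0.
Qed.

Lemma coef_sumel f K e : coef (sumel f K) e = if e \in K then f e else 0.
Proof.
rewrite /coef ip_sumr; case: ifPn => eK.
  rewrite (big_fsetD1 e)//= ipZr el_ip !eqxx mulr1 big_seq big1 ?addr0// => t.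
  rewrite in_fsetD1 eq_sym => /andP[/negPf et _].
  by rewrite ipZr el_ip et mulr0.
rewrite big_seq big1// => t tK; rewrite ipZr el_ip.
by case: eqVneq eK => [->|]; rewrite ?tK// mulr0.
Qed.

Lemma ip_sumel_self f K v :
  ip (sumel f K) (sumel f K) v = \sum_(e <- K | src e == v) `|f e| ^+ 2.
Proof.
rewrite ip_sumel big_seq_cond [RHS]big_seq_cond; apply: eq_bigr => e.
by move=> /andP[eK _]; rewrite coef_sumel eK normCKC.
Qed.

(** Pythagoras: the partial sum has the same inner product with [x] as with itself. *)
Lemma ip_sub_sumel x K v :
  ip (x - sumel (coef x) K) (x - sumel (coef x) K) v =
  ip x x v - \sum_(e <- K | src e == v) `|coef x e| ^+ 2.
Proof.
have s : ip (sumel (coef x) K) x v = ip (sumel (coef x) K) (sumel (coef x) K) v.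
  by rewrite ip_sumel_self ip_sumel; apply: eq_bigr => e _; rewrite normCKC.
rewrite !(ipBr, ipBl) -(ip_conj (sumel _ _) x) s ip_conj ip_sumel_self.
by rewrite subrr subr0.
Qed.

Lemma bessel x K v : \sum_(e <- K | src e == v) `|coef x e| ^+ 2 <= ip x x v.
Proof. by rewrite -subr_ge0 -ip_sub_sumel ip_ge0. Qed.

Lemma coef_le x e : `|coef x e| <= `|x|.
Proof.
rewrite -(@ler_pXn2r _ 2) ?nnegrE//.
apply: le_trans (ip_le_norm x (src e)); have := bessel x [fset e]%fset (src e).
by rewrite big_mkcond big_seq_fset1 eqxx.
Qed.

Lemma sum_fiber (F : edge E -> C) K v : [set` K] `<=` fiber v ->
  \sum_(e <- K) F e = \sum_(e <- K | src e == v) F e.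
Proof.
move=> Kv; rewrite big_seq [RHS]big_seq_cond; apply: eq_bigl => e.
by case: (boolP (e \in K)) => // /Kv /= ->; rewrite eqxx.
Qed.

(** Bessel's inequality gives convergence over each fiber and bounds the sums by [ip x x], which
    vanishes at infinity. *)
Lemma coef_square_summable x : square_summable_pred (coef x).
Proof.
have sq0 v e : fiber v e -> 0 <= `|coef x e| ^+ 2.
  by move=> _; exact: exprn_ge0.
have /choice[l lP] v : exists l : C,
    has_sum (fiber v) (fun e => `|coef x e| ^+ 2) l /\ 0 <= l <= ip x x v.
  have le K : [set` K] `<=` fiber v ->
      \sum_(e <- K) `|coef x e| ^+ 2 <= ip x x v.
    by move=> Kv; rewrite (sum_fiber _ Kv) bessel.
  have [l [sl _ lx]] := nneg_sum (sq0 v) le.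
  exists l; split=> //; rewrite (nneg_has_sum_ge0 (sq0 v) sl)/=.
  exact: lx.
have vl : vanishing_pred l.
  apply/asboolP/(vanishing_dom ler01 _ (c0_vanishing (inner x x))) => v.
  have [_ /andP[l0 lx]] := lP v; rewrite mul1r (ger0_norm l0).
  by rewrite (le_trans lx)// real_ler_norm// ger0_real// ip_ge0.
by apply/asboolP; exists (C0 vl) => v; have [] := lP v.
Qed.

Definition coef_gs x : graph_space R E := GraphSpace (coef_square_summable x).

(** The point is uniformity in [v]. The full fiber sum is below [d] except at finitely many [v]; for
    each of these a finite set of edges leaves a remainder of at most [d], and [G] is the union of
    these sets. *)
Lemma gs_tail (f : graph_space R E) d : 0 < d ->
  exists G : {fset edge E}, forall K, [disjoint K & G]%fset ->
    forall v, \sum_(e <- K | src e == v) `|f e| ^+ 2 <= d.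
Proof.
move=> d0; pose a := gs_inner f f.
have f0 v e : fiber v e -> 0 <= `|f e| ^+ 2 by move=> _; exact: exprn_ge0.
have /choice[G GP] v : exists G : {fset edge E}, forall K,
    [disjoint K & G]%fset -> \sum_(e <- K | src e == v) `|f e| ^+ 2 <= d.
  have [G Gv aG] := gs_inner_sqr f v d0.
  exists G => K KG; rewrite big_fset_condE; set K' := [fset _ in _ | _]%fset.
  have := aG G (fsubset_refl G) Gv.
  have K'E e : (e \in K') = (e \in K) && (src e == v) by rewrite !inE.
  have Uv : [set` (K' `|` G)%fset] `<=` fiber v.
    by apply: Defs.fsubU => // e /=; rewrite K'E => /andP[_ /eqP].
  have := (nneg_has_sum (f0 v) (gs_inner_sqr f v)).1 _ Uv.
  clearbody K'; move=> le lt.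
  (* [K'] and [G] are disjoint subsets of the fiber: their sums add up to at most [a v], while the
     sum over [G] already exceeds [a v - d]. *)
  have UE : \sum_(e <- (K' `|` G)%fset) `|f e| ^+ 2 =
      \sum_(e <- K') `|f e| ^+ 2 + \sum_(e <- G) `|f e| ^+ 2.
    rewrite (big_fsetID _ (fun e => e \in K'))/=; congr (_ + _).
      by apply: eq_fbigl => e; rewrite !inE/= andbC; case: (e \in K').
    apply: eq_fbigl => e; rewrite !inE/= K'E.
    have /fdisjointP/(_ e) := KG.
    case: (e \in K) => //= [/(_ isT)/negPf ->|_]; last by rewrite andbT.
    by case: (src e == v).
  rewrite UE in le.
  have {}lt := le_lt_trans (real_ler_norm (ger0_real _)) lt.
  rewrite -(lerD2r (\sum_(e <- G) `|f e| ^+ 2)); apply: le_trans le _.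
  rewrite -lerBlDr; apply/ltW/lt; rewrite subr_ge0.
  exact: (nneg_has_sum (f0 v) (gs_inner_sqr f v)).1.
have /finite_fsetP[F FE] := c0_vanishing a d0.
exists (\bigcup_(v <- F) G v)%fset => K KG v.
have [vF|vF] := boolP (v \in F).
  apply: (GP v); apply: fdisjointWr KG.
  exact: (@bigfcup_sup _ _ _ v).
rewrite big_fset_condE.
apply: le_trans ((nneg_has_sum (f0 v) (gs_inner_sqr f v)).1 _ _) _.
  by move=> e; rewrite /= !inE => /andP[_ /eqP].
apply/ltW/(le_lt_trans (real_ler_norm (ger0_real (gs_inner_pt_ge0 f v)))).
rewrite real_ltNge ?normr_real ?gtr0_real//; apply: contra vF => dv.
by have : [set` F] v by rewrite -FE.
Qed.

Lemma sumel_split f G K : (G `<=` K)%fset ->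
  sumel f K = sumel f G + sumel f [fset e in K | e \notin G]%fset.
Proof.
move=> /fsubsetP GK; rewrite {1}/sumel (big_fsetID _ (mem G))/=; congr (_ + _).
apply: eq_fbigl => e; rewrite !inE/=.
by case: (boolP (e \in G)) => [/GK ->|]; rewrite ?andbF.
Qed.

(** Riesz-Fischer: by [gs_tail] the partial sums are Cauchy along the finite sets of edges, and [X]
    is complete. *)
Lemma gs_expansion (f : graph_space R E) :
  exists2 x, coef x =1 f & forall d, 0 < d -> exists G : {fset edge E},
    forall K, (G `<=` K)%fset -> `|x - sumel f K| <= d.
Proof.
have tail d : 0 < d -> exists G : {fset edge E}, forall K, (G `<=` K)%fset ->
    `|sumel f G - sumel f K| <= d.
  move=> d0; have [G GP] := gs_tail f (exprn_gt0 2 d0).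
  exists G => K GK; rewrite distrC (sumel_split f GK) addrC addKr.
  apply/normr_ipP => [|v]; first exact: ltW.
  rewrite ip_sumel_self; apply: GP; apply/fdisjointP => e.
  by rewrite !inE => /andP[].
have FF := @totally_filter (edge E).
have : cvg (sumel f @ totally).
  apply: cauchy_cvg; apply/cauchyP => d d0.
  have [|G GP] := tail (d / 2); first by rewrite divr_gt0.
  exists (sumel f G), G => // K /GP le.
  rewrite /= -ball_normE /=; apply: le_lt_trans le _.
  by rewrite ltr_pdivrMr// ltr_pMr// ltr1n.
move=> /cvg_ex[x /cvgrPdist_le xP].
have lim d : 0 < d -> exists G : {fset edge E},
    forall K, (G `<=` K)%fset -> `|x - sumel f K| <= d.
  by move=> /xP[G _ GP]; exists G.
exists x => // e; apply/eqP; rewrite -subr_eq0 -normr_le0.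
apply/ler_addgt0Pl => d d0; rewrite addr0.
have [G GP] := lim _ d0.
(* Once [e] belongs to the index set, the partial sum has coefficient exactly [f e] at [e], so
   [coef_le] applied to the remainder bounds [coef x e - f e]. *)
apply: le_trans (GP (e |` G)%fset _); last by rewrite fsubsetU1.
apply: le_trans (coef_le _ e).
by rewrite /coef ipBr -!/(coef _ _) coef_sumel !inE eqxx.
Qed.

(** The Fourier series of [x] converges to a vector with the same coefficients, hence to [x] by
    [el_total]; the remainder in [ip_sub_sumel] then tends to zero. *)
Lemma parseval x v : gs_inner (coef_gs x) (coef_gs x) v = ip x x v.
Proof.
apply: has_sum_unique (gs_inner_sqr _ v) _ => d d0.
have [y yx lim] := gs_expansion (coef_gs x).
have xy : y = x.
  apply/eqP; rewrite -subr_eq0; apply/eqP/el_total => e.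
  by rewrite ipBr -!/(coef _ _) yx subrr.
rewrite {y yx}xy in lim.
have [|G GP] := lim (sqrtC (d / 2)); first by rewrite sqrtC_gt0 divr_gt0.
exists [fset e in G | src e == v]%fset => [e|K GK Kv].
  by rewrite /= !inE => /andP[_ /eqP].
(* [lim] needs a set containing all of [G], while [K] is only known to contain the edges of [G] with
   source [v]. Adding the rest of [G] changes nothing at [v]. *)
have := GP (G `|` K)%fset (fsubsetUl _ _).
move=> /normr_ipP => /(_ _ v); rewrite ip_sub_sumel sqrtCK.
rewrite (_ : \sum_(e <- (G `|` K)%fset | _) _ = \sum_(e <- K) `|coef x e| ^+ 2).
  have d20 : 0 <= d / 2 by rewrite divr_ge0// ltW.
  rewrite sqrtC_ge0 d20 => /(_ isT) le.
  rewrite ger0_norm; last by rewrite subr_ge0 (sum_fiber _ Kv) bessel.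
  by apply: le_lt_trans le _; rewrite ltr_pdivrMr// ltr_pMr// ltr1n.
rewrite (sum_fiber _ Kv); apply: eq_fbigl_cond => e; rewrite !inE.
case: (boolP (src e == v)) => ev; rewrite ?andbF// !andbT.
apply/orP/idP => [[eG|//]|->]; last by right.
by apply: (fsubsetP GK); rewrite !inE eG.
Qed.

Lemma coef_linear : linear coef_gs.
Proof. by move=> k x y; apply: gsP => e; rewrite [LHS]ip_linear. Qed.

Lemma coef_bimodule a b x :
  coef_gs (ract (lact a x) b) =
  ract (lact a (coef_gs x : graph_correspondence R E)) b.
Proof.
apply: gsP => e; rewrite [LHS]ip_ractr -[a]cstarK -ip_lact el_lact ipZl.
by rewrite cstarK [X in X * _ * _]conjCK.
Qed.

(** Polarization: the difference [D] of the two forms is sesquilinear and zero on the diagonal by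
    Parseval. Expanding it at [k *: w + z] gives [Dr]; [k = 'i] makes [D] symmetric and [k = 1]
    antisymmetric. *)
Lemma coef_inner x y : gs_inner (coef_gs x) (coef_gs y) = inner x y.
Proof.
pose Y := graph_correspondence R E.
pose D z w v := ip (coef_gs z : Y) (coef_gs w) v - ip z w v.
have D0 z v : D z z v = 0 by rewrite /D [X in X - _]parseval subrr.
have Dlin z k w w' v : D z (k *: w + w') v = k * D z w v + D z w' v.
  by rewrite /D coef_linear !ip_linear opprD addrACA mulrBr.
have Dconj z w v : (D z w v)^* = D w z v.
  by rewrite /D rmorphB /= !ip_conj.
have Dl z k w w' v : D (k *: w + w') z v = k^* * D w z v + D w' z v.
  by rewrite -Dconj Dlin rmorphD rmorphM /= !Dconj.
have Dr k z w v : k * D z w v + k^* * D w z v = 0.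
  have := D0 (k *: w + z) v.
  by rewrite Dlin !Dl !D0 mulr0 add0r addr0.
apply: c0P => v; apply/eqP; rewrite -subr_eq0 -/(D x y v).
have /eqP := Dr 'i x y v.
rewrite conjCi mulNr -mulrBr mulf_eq0 (negPf (neq0Ci _)).
rewrite subr_eq0 /= => /eqP xy.
have /eqP := Dr 1 x y v; rewrite conjC1 !mul1r -xy -mulr2n mulrn_eq0.
by [].
Qed.

(** Surjectivity is [gs_expansion], injectivity is [el_total]. *)
Lemma coef_isomorphism : corr_isomorphic X (graph_correspondence R E).
Proof.
exists (coef_gs : X -> graph_correspondence R E).
  split; [exact: coef_linear|exact: coef_bimodule|exact: coef_inner].
have /choice[g gP] (f : graph_space R E) : exists x, coef_gs x = f.
  by have [x xf _] := gs_expansion f; exists x; apply: gsP.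
exists g => // x; apply/eqP; rewrite -subr_eq0; apply/eqP/el_total => e.
have /(congr1 (fun f : graph_space R E => f e)) /= ge := gP (coef_gs x).
by rewrite ipBr -!/(coef _ _) ge subrr.
Qed.

End OrthonormalFamily.

(** * Maximal orthonormal sets of block vectors, and their countability *)

Section MaximalFamily.
Variables (R : realType) (V : countType) (X : correspondence (c0_alg R V)).
Implicit Types (x y z : X) (a : c0_alg R V) (v w : V) (B : set X).

(* A unit vector of the Hilbert space [delta w . X . delta v]. *)
Definition matrix_unit w v x : Prop :=
  [/\ lact (delta R w) x = x, ract x (delta R v) = x & inner x x = delta R v].

Lemma matrix_unit_lact w v x a : matrix_unit w v x ->
  lact a x = (a : c0 R V) w *: x.
Proof.
case=> xw _ _; rewrite -[in LHS]xw -lactM.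
rewrite (_ : cmul a _ = (a : c0 R V) w *: delta R w) ?lactZl ?xw//.
apply: c0P => t; transitivity ((a : c0 R V) t * (t == w)%:R) => //.
transitivity ((a : c0 R V) w * (t == w)%:R) => //.
by case: eqVneq => [->|]//; rewrite !mulr0.
Qed.

Lemma matrix_unit_ip w v x y t : matrix_unit w v x ->
  ip x y t = (v == t)%:R * ip x y t.
Proof.
by case=> _ xv _; rewrite -{1}xv ip_ractl deltaE conjC_nat eq_sym.
Qed.

Lemma matrix_unit_ract w v x a : matrix_unit w v x ->
  ract x a = (a : c0 R V) v *: x.
Proof.
move=> xu; apply: ip_sep => z t; rewrite ip_ractr ipZr -(ip_conj x z).
rewrite (matrix_unit_ip _ _ xu) rmorphM /= conjC_nat.
by case: eqVneq => [->|_]; [rewrite mulrC|rewrite !mul0r mulr0].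
Qed.

Definition orthonormal B : Prop :=
  (forall x, B x -> exists w v, matrix_unit w v x) /\
  (forall x y, B x -> B y -> x <> y -> inner x y = 0).

(** Zorn's lemma. If a nonzero [x] were orthogonal to a maximal [B], some [delta w . x . delta v]
    would be nonzero by [delta_total], and normalized it would enlarge [B]. *)
Lemma maximal_orthonormal : corr_nondegenerate X ->
  exists2 B, orthonormal B &
    forall x, (forall b v, B b -> ip b x v = 0) -> x = 0.
Proof.
move=> nd.
have [|B [[Bu Bo] Bmax]] := @Zorn_bigcup X orthonormal.
  move=> F FP tot; split=> [x [B FB Bx]|x y [B FB Bx] [B' FB' B'y]].
    exact: (FP B FB).1.
  have [BB'|B'B] := tot _ _ FB FB'.
    by apply: (FP B' FB').2 => //; exact: BB'.
  by apply: (FP B FB).2 => //; exact: B'B.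
exists B => // x Bx; apply: (delta_total nd) => w; apply: ip_eq0 => v.
apply/eqP/negPn/negP; set c := ip _ _ v => cn0.
have c_gt0 : 0 < c by rewrite lt_def cn0 ip_ge0.
pose k := (sqrtC c)^-1.
pose y := ract (lact (delta R w) (k *: x)) (delta R v).
have yu : matrix_unit w v y.
  split; first by rewrite /y lact_ract -lactM delta_idem.
    by rewrite ractA delta_idem.
  apply: c0P => t; rewrite -[LHS]/(ip y y t) ip_ractr ip_ractl deltaE conjC_nat.
  case: eqVneq => [->|_]; last by rewrite mulr0.
  rewrite mulr1 mul1r lactZr ipZl ipZr -/c mulrA -normCKC.
  by rewrite ger0_norm ?invr_ge0 ?sqrtC_ge0 ?ip_ge0// exprVn sqrtCK mulVf.
(* Both compressions act on inner products with [b] as scalars, so orthogonality to [x] passes to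
   [y]. *)
have yo b : B b -> inner b y = 0.
  move=> Bb; have [w' [v' bu]] := Bu _ Bb; apply: c0P => t.
  rewrite -[LHS]/(ip b y t) ip_ractr -delta_star -ip_lact.
  by rewrite (matrix_unit_lact _ bu) ipZl ipZr Bx// !mulr0 mul0r.
(* This keeps [y] out of [B]: a member of [B] would be orthogonal to [y], hence [y] to itself. *)
have yn0 : inner y y <> 0.
  have [_ _ ->] := yu => /(congr1 (fun f : c0 R V => f v))/eqP.
  by rewrite [X in X == _]deltaE eqxx oner_eq0.
apply: (Bmax (B `|` [set y])).
  split; first by move=> z; left.
  by move=> /(_ y (or_intror erefl))/yo.
split=> [z [/Bu//|->]|z z' [Bz|->] [Bz'|->] zz'].
- by exists w, v.
- exact: Bo.
- exact: yo.
- by rewrite -inner_star yo//; apply: c0P => t; exact: conjC0.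
- by [].
Qed.

(** Pythagoras at the point [v] where [inner x x] takes the value 1. *)
Lemma orthonormal_dist B x y : orthonormal B -> B x -> B y -> x <> y ->
  1 <= `|x - y|.
Proof.
move=> [Bu Bo] Bx By xy; have [w [v [_ _ xx]]] := Bu _ Bx.
rewrite -(@ler_pXn2r _ 2) ?nnegrE// expr1n.
apply: le_trans (ip_le_norm _ v).
have xy0 : ip x y v = 0 by rewrite /ip Bo.
rewrite !(ipBr, ipBl) xy0 -(ip_conj x y) xy0 conjC0 subr0 sub0r opprK.
by rewrite {1}/ip xx deltaE eqxx lerDl ip_ge0.
Qed.

(** Members of [B] are at distance at least 1, so no two lie within less than 1/2 of the same point
    of a countable dense set. *)
Lemma orthonormal_countable B :
  corr_separable X -> orthonormal B -> countable B.
Proof.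
move=> [D /countable_injP[code codeI] dD] Bon; apply/countable_injP.
have /choice[d dP] x : exists d : X, D d /\ `|x - d| < 2^-1.
  by have [|d] := dense_near dD x (e := 2^-1); [rewrite invr_gt0|exists d].
exists (code \o d) => x y /set_mem Bx /set_mem By.
move=> /(codeI _ _ (mem_set (dP x).1) (mem_set (dP y).1)) dxy.
apply: contrapT => xy.
have := orthonormal_dist Bon Bx By xy => /le_gtF/negP; apply.
rewrite -[x](subrK (d x)) -addrA [1]splitr mul1r.
apply: le_lt_trans (ler_normD _ _) _; apply: ltrD; first exact: (dP x).2.
by rewrite dxy distrC; exact: (dP y).2.
Qed.

End MaximalFamily.

(** * Construction of the graph from a maximal orthonormal set *)

Theorem theorem1p1 (R : realType) (V : countType)
    (X : correspondence (c0_alg R V)) :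
  corr_separable X -> corr_nondegenerate X ->
  exists E : digraph V, corr_isomorphic X (graph_correspondence R E).
Proof.
move=> sep nd; have [B Bon Bmax] := maximal_orthonormal nd.
have /countable_injP[code codeI] := orthonormal_countable sep Bon.
(* Edges must form a [countType], so [B] is replaced by the set of its codes in [nat]. *)
pose edges : countType := {n : nat | `[< exists2 x, B x & code x = n >]}.
have /choice[el elP] (e : edges) : exists x, B x /\ code x = val e.
  by have /asboolP[x Bx xe] := valP e; exists x.
have /choice[p pP] (e : edges) : exists p : V * V, matrix_unit p.1 p.2 (el e).
  by have [w [v u]] := Bon.1 _ (elP e).1; exists (w, v).
have codeB x y : B x -> B y -> code x = code y -> x = y.
  by move=> /mem_set Bx /mem_set By; exact: codeI.
(* The left block index is the range and the right one the source, as in the actions on the graph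
   correspondence. *)
pose E := @Digraph V edges (fun e => (p e).1) (fun e => (p e).2).
exists E; apply: (@coef_isomorphism R V X E el) => [e a|e a|e e' v|x x0] /=.
- exact: matrix_unit_lact (pP e).
- exact: matrix_unit_ract (pP e).
- case: eqVneq => [<-|ee'] /=.
    by have [_ _ ee] := pP e; rewrite /ip ee deltaE eq_sym.
  rewrite /ip (Bon.2 _ _ (elP e).1 (elP e').1)// => elE.
  case/eqP: ee'; apply: val_inj.
  by rewrite -(elP e).2 -(elP e').2 elE.
- apply: Bmax => b v Bb.
  have be : `[< exists2 x, B x & code x = code b >] by apply/asboolP; exists b.
  pose e : edges := Sub (code b) be.
  have <- : el e = b by apply: codeB => //; [exact: (elP e).1|exact: (elP e).2].
  (* The hypothesis covers only the point [src e]; at every other point the inner product with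
     [el e] vanishes anyway. *)
  rewrite (matrix_unit_ip _ _ (pP e)).
  by case: eqVneq => [<-|_]; [rewrite x0 mulr0|rewrite mul0r].
Qed.
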